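(* Let $n,B\ge 1$ be integers, $\rho>0$, and let $\mathcal{Q}\subset\mathbb{R}^{nB}$ be a compact set such that $\|\mathbf{x}\|_\infty\le\rho/2$ for all $\mathbf{x}\in\mathcal{Q}$. Let $\mathcal{C}$ denote the codebook of a rate-$r$, distortion-$\delta$ lossy compression code $(f,g)$ for $\mathcal{Q}$. Let $q_0,q_1\le 0.5$. Let $\mathbf{D}_i=\mathrm{diag}(D_{i1},\ldots,D_{in})$, $i=1,\ldots,B$, with $D_{ij}\in\{0,1\}$, where the $n$ sequences $(D_{1j},\ldots,D_{Bj})$, $j=1,\ldots,n$, are generated independently of each other, each as a stationary first-order Markov process with transition probabilities $$\mathrm{P}(D_{ij}=1\mid D_{i-1,j}=0)=q_0,\qquad \mathrm{P}(D_{ij}=0\mid D_{i-1,j}=1)=q_1,\qquad i=2,\ldots,B,$$ and let $p=\mathrm{P}(D_{ij}=1)=\frac{q_0}{q_0+q_1}\in(0,1)$. Let $\alpha=1-q_0-q_1$ and let $\Lambda$ be the $B\times B$ matrix with entries $\Lambda_{ik}=\alpha^{|i-k|}$ (with ones on the diagonal), with maximum and minimum eigenvalues $\lambda_{\max}(\Lambda)$ and $\lambda_{\min}(\Lambda)$. For $\mathbf{x}\in\mathcal{Q}$ and $\mathbf{y}=\sum_{i=1}^B\mathbf{D}_i\mathbf{x}_i$, let $\hat{\mathbf{x}}$ be a solution of $$\hat{\mathbf{x}}=\arg\min_{\mathbf{c}\in\mathcal{C}}\Big\|\mathbf{y}-\sum_{i=1}^B\mathbf{D}_i\mathbf{c}_i\Big\|_2^2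 .$$ Let $\epsilon>0$. Then, if $\lambda_{\min}(\Lambda)>0$, $$\frac{1}{nB}\|\mathbf{x}-\hat{\mathbf{x}}\|_2^2\le\frac{\lambda_{\max}(\Lambda)(1-p)+pB}{\lambda_{\min}(\Lambda)(1-p)}\cdot\frac{\delta}{nB}+\frac{\rho^2\epsilon}{\lambda_{\min}(\Lambda)\,p(1-p)}$$ with probability larger than $1-2^{Br+1}\exp\big(-\frac{n\epsilon^2}{2B^2}\big)$.
   Context: A vector $\mathbf{x}\in\mathbb{R}^{nB}$ is viewed as the concatenation of $B$ frames $\mathbf{x}_1,\ldots,\mathbf{x}_B\in\mathbb{R}^n$; similarly $\mathbf{c}\in\mathbb{R}^{nB}$ has frames $\mathbf{c}_1,\ldots,\mathbf{c}_B$. A lossy compression code of rate $r$ for $\mathcal{Q}$ is a pair of maps $f:\mathcal{Q}\to\{1,2,\ldots,2^{Br}\}$ (encoder) and $g:\{1,2,\ldots,2^{Br}\}\to\mathbb{R}^{nB}$ (decoder). Its distortion is $\delta=\sup_{\mathbf{x}\in\mathcal{Q}}\|\mathbf{x}-g(f(\mathbf{x}))\|_2^2$, and its codebook is $\mathcal{C}=\{g(f(\mathbf{x})):\mathbf{x}\in\mathcal{Q}\}$, so $|\mathcal{C}|\le 2^{Br}$. The probability is over the random masks $\mathbf{D}_1,\ldots,\mathbf{D}_B$, with $\mathbf{x}$ fixed.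
   Formalization: The formal theorem additionally assumes that every codeword c in the codebook satisfies ‖c‖_∞ ≤ ρ/2, as the signals in Q do; with an arbitrary decoder into R^{nB} the stated bound is false. *)

(* Defs.v *)
(* MathComp / MathComp-Analysis *)
From HB Require Import structures.
From mathcomp Require Import all_boot all_order all_algebra.
From mathcomp Require Import all_classical all_reals all_analysis.

Set Implicit Arguments.
Unset Strict Implicit.
Unset Printing Implicit Defensive.

Import Order.TTheory GRing.Theory Num.Theory.
Import numFieldNormedType.Exports.

Local Open Scope classical_set_scope.
Local Open Scope ring_scope.

Section Signals.
Variables (R : realType) (B n : nat).

Definition l2sq (m k : nat) (A : 'M[R]_(m, k)) : R :=
  \sum_i \sum_j A i j ^+ 2.

(* [mxvec] concatenates the rows of a B x n matrix, so the i-th frame of a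
   vector of length B * n is row i of [vec_mx x]; it is returned as a column. *)
Definition frame (x : 'rV[R]_(B * n)) (i : 'I_B) : 'cV[R]_n :=
  (row i (vec_mx x))^T.

Definition mask (d : 'I_n -> bool) : 'M[R]_n :=
  diag_mx (\row_j (d j)%:R).

Definition measurement (d : 'I_B -> 'I_n -> bool) (x : 'rV[R]_(B * n)) :
    'cV[R]_n :=
  \sum_i mask (d i) *m frame x i.

End Signals.

Section Codes.
Variables (R : realType) (B n : nat).
Implicit Types (Q C : set 'rV[R]_(B * n)) (r : R).
Implicit Types (f : 'rV[R]_(B * n) -> nat) (g : nat -> 'rV[R]_(B * n)).

(* Messages are the integers m with 1 <= m <= 2^(B r); the rate r is real and
   2^(B r) need not be an integer.  [f] is only constrained on [Q], and [g] is
   only ever used on messages. *)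
Definition encoder_of_rate Q r f : Prop :=
  forall x, Q x -> (1 <= f x)%N /\ (f x)%:R <= 2 `^ (B%:R * r) :> R.

(* The supremum is taken over a bounded set when [Q] is bounded, because the
   codebook of a code of finite rate is finite. *)
Definition distortion Q f g : R := sup [set l2sq (x - g (f x)) | x in Q].

Definition codebook Q f g : set 'rV[R]_(B * n) := [set g (f x) | x in Q].

Definition is_solution C (d : 'I_B -> 'I_n -> bool) (y : 'cV[R]_n)
    (xhat : 'rV[R]_(B * n)) : Prop :=
  C xhat /\
  forall c, C c -> l2sq (y - measurement d xhat) <= l2sq (y - measurement d c).

End Codes.

Section Processes.
Context {dT : measure_display} {T : measurableType dT} {R : realType}.
Variable P : probability T R.

Definition cprob (E F : set T) : R := fine (P (E `&` F)) / fine (P F).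

Definition mutually_independent (n : nat) (U : finType) (X : 'I_n -> T -> U) :
    Prop :=
  forall A : 'I_n -> {set U},
    P [set w | forall j, X j w \in A j] =
    (\prod_(j < n) P [set w | X j w \in A j])%E.

Variables (B : nat) (X : 'I_B -> T -> bool).

Definition stationary : Prop :=
  forall (s m : nat) (a : nat -> bool), (s + m <= B)%N ->
    P [set w | forall i : 'I_B, (s <= i < s + m)%N -> X i w = a (i - s)%N] =
    P [set w | forall i : 'I_B, (i < m)%N -> X i w = a i].

Definition past (i : 'I_B) (a : 'I_B -> bool) : set T :=
  [set w | forall l : 'I_B, (l <= i)%N -> X l w = a l].

Definition markov1 : Prop :=
  forall (i k : 'I_B) (a : 'I_B -> bool) (b : bool), k = i.+1 :> nat ->
    P (past i a) != 0%E ->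
    cprob [set w | X k w = b] (past i a) =
    cprob [set w | X k w = b] [set w | X i w = a i].

Definition transition (b b' : bool) (q : R) : Prop :=
  forall i k : 'I_B, k = i.+1 :> nat ->
    cprob [set w | X k w = b'] [set w | X i w = b] = q.

End Processes.

Section Spectrum.
Variables (R : realType) (B : nat).

Definition Lambda (alpha : R) : 'M[R]_B :=
  \matrix_(i, k) alpha ^+ `|i - k|%N.

(* For a real symmetric matrix of positive size, the eigenvalues in [R] form a
   nonempty finite set, so these are its maximum and minimum. *)
Definition lambda_max (A : 'M[R]_B) : R := sup [set a | eigenvalue A a].
Definition lambda_min (A : 'M[R]_B) : R := inf [set a | eigenvalue A a].

End Spectrum.

(* Main.v *)
(* For z = x - c, the energy of sum_i D_i z_i is a sum over the n coordinates j
   of independent terms (sum_i D_ij z_ij)^2.  The Markov property gives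
   E[D_ij D_kj] = p^2 + p (1 - p) alpha^|i-k|, so the mean of the j-th term is
   p^2 (sum_i z_ij)^2 + p (1 - p) z_j^T Lambda z_j.  Cauchy-Schwarz and the
   Rayleigh quotient of Lambda then compare the mean energy with |z|^2 on both
   sides.  Each term lies in [0, (B rho)^2], so Hoeffding's inequality with
   deviation n B rho^2 eps / 2 bounds the tails.  The minimality of xhat
   compares its energy with the energy of g (f x), and a union bound over the
   messages concludes.  Since the masks take finitely many values, all
   expectations are finite sums. *)
Require Import Defs.
From HB Require Import structures.
From mathcomp Require Import all_boot all_order all_algebra.
From mathcomp Require Import all_classical all_reals all_analysis.
From mathcomp Require Import ring lra.

Import Order.TTheory GRing.Theory Num.Theory.
Import numFieldNormedType.Exports.

Local Open Scope classical_set_scope.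
Local Open Scope ring_scope.

Set Implicit Arguments.
Unset Strict Implicit.
Unset Printing Implicit Defensive.

(** * Hoeffding's inequality under finite product laws *)

Section Hoeffding.
Variable R : realType.

Lemma is_derive_ge0_homo0 (f df : R -> R) (h : R) : 0 <= h ->
  (forall x : R, 0 <= x -> is_derive x 1 f (df x)) ->
  (forall x : R, 0 <= x -> 0 <= df x) -> f 0 <= f h.
Proof.
move=> h0 fdf df0.
have cf : {within `[0, h], continuous f}.
  apply: derivable_within_continuous => x; rewrite in_itv/= => /andP[x0 _].
  by have [] := fdf _ x0.
have fdf' x : x \in `]0, h[ -> is_derive x 1 f (df x).
  by rewrite in_itv/= => /andP[/ltW x0 _]; exact: fdf.
have [x + e] := MVT_segment h0 fdf' cf.
rewrite in_itv/= => /andP[x0 _].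
by rewrite -subr_ge0 e mulr_ge0// ?df0// subr0.
Qed.

(** The logarithmic gap [G] between the two sides and its derivative [M] both vanish at 0, and the
    derivative of [M] is 1/4 - v (1 - v) with v = theta e^x / K(x), hence nonnegative. Two
    integrations from 0 give the bound. *)
Lemma hoeffding_bernoulli_ge0 (theta h : R) : 0 <= theta <= 1 -> 0 <= h ->
  1 - theta + theta * expR h <= expR (theta * h + h ^+ 2 / 8).
Proof.
move=> /andP[t0 t1] h0.
pose K (x : R) : R := 1 - theta + theta * expR x.
have K0 x : 0 < K x.
  by rewrite /K; have := expR_gt0 x; nra.
have dK (x : R) : is_derive x 1 K (theta * expR x).
  rewrite /K; apply: is_derive_eq.
  by rewrite add0r mul1r.
pose M (x : R) : R := theta + x / 4 - theta * expR x / K x.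
have dM (x : R) : is_derive x 1 M (4^-1 - theta * expR x * (1 - theta) / K x ^+ 2).
  have Kx := lt0r_neq0 (K0 x).
  have dV := is_deriveV Kx (dK x).
  have -> : M = (fun y => theta + y * 4^-1 - (theta * expR y) * (K y)^-1) by [].
  apply: is_derive_eq; rewrite ?scaler0 ?scale0r /GRing.scale/=.
  have -> : theta * expR x = K x - (1 - theta) by rewrite /K; ring.
  by field; rewrite Kx.
have M0 : M 0 = 0 by rewrite /M /K expR0 mulr1 subrK; field.
have Mge0 x : 0 <= x -> 0 <= M x.
  move=> x0; rewrite -M0; apply: (is_derive_ge0_homo0 x0 (fun (y : R) _ => dM y)).
  move=> y _; rewrite subr_ge0 ler_pdivrMr ?exprn_gt0// /K.
  have := expR_gt0 y; set e := expR y => e0.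
  (* This is 4 a b <= (a + b)^2 for a = theta e and b = 1 - theta, whose sum is [K y]. *)
  by have := sqr_ge0 (theta * e - (1 - theta)); lra.
pose G (x : R) : R := theta * x + x ^+ 2 / 8 - ln (K x).
have dG (x : R) : is_derive x 1 G (M x).
  have dln := is_derive1_ln (K0 x).
  have dlnK : is_derive x 1 (@ln R \o K) _ := is_derive1_comp dln (dK x).
  have -> : G = (fun y => theta * y + y ^+ 2 * 8^-1 - (@ln R \o K) y) by [].
  apply: is_derive_eq; rewrite ?scaler0 ?scale0r /GRing.scale/= /M.
  by field; rewrite lt0r_neq0// K0.
have := is_derive_ge0_homo0 h0 (fun (y : R) _ => dG y) Mge0.
rewrite /G {1}/K expR0 mulr0 expr0n mul0r addr0 mulr1 subrK ln1 subr0.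
by rewrite subr_ge0 -ler_expR lnK ?posrE.
Qed.

Lemma expR_chord (t h : R) : 0 <= t <= 1 -> expR (t * h) <= 1 - t + t * expR h.
Proof.
move=> /andP[t0 t1]; have := convex_expR (Itv01 t0 t1) h 0.
by rewrite !convRE/= expR0 mulr0 addr0 mulr1 addrC.
Qed.

Variables (U : finType) (c : R).
Hypothesis c_gt0 : 0 < c.

(** On [0, c] the exponential lies below its chord, so [Y] may be replaced by c times a Bernoulli
    variable with the same mean, of parameter [theta]. *)
Lemma hoeffding_mgf (mu Y : U -> R) (s : R) :
  (forall b, 0 <= mu b) -> \sum_b mu b = 1 -> (forall b, 0 <= Y b <= c) ->
  0 <= s ->
  \sum_b mu b * expR (s * Y b) <=
  expR (s * (\sum_b mu b * Y b) + (s * c) ^+ 2 / 8).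
Proof.
move=> mu0 mu1 Yc s0.
have cn0 : c != 0 by rewrite gt_eqF.
pose theta := (\sum_b mu b * Y b) / c.
have Y01 b : 0 <= Y b / c <= 1.
  have /andP[Y0 Y1] := Yc b.
  by rewrite divr_ge0 ?(ltW c_gt0)//= ler_pdivrMr// mul1r.
have thetaE : theta = \sum_b mu b * (Y b / c).
  by rewrite /theta mulr_suml; apply: eq_bigr => b _; rewrite mulrA.
have theta01 : 0 <= theta <= 1.
  rewrite thetaE sumr_ge0 => [/=|b _]; last first.
    by rewrite mulr_ge0//; case/andP: (Y01 b).
  rewrite -mu1; apply: ler_sum => b _.
  by rewrite ler_piMr//; case/andP: (Y01 b).
have -> : s * (\sum_b mu b * Y b) = theta * (s * c).
  by rewrite /theta; field.
apply: le_trans (hoeffding_bernoulli_ge0 theta01 (mulr_ge0 s0 (ltW c_gt0))).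
have -> : 1 - theta + theta * expR (s * c) =
    \sum_b mu b * (1 - Y b / c + Y b / c * expR (s * c)).
  under eq_bigr do rewrite mulrDr mulrBr mulr1 mulrA.
  by rewrite big_split/= sumrB -mulr_suml mu1 -thetaE.
apply: ler_sum => b _; apply: ler_wpM2l => //.
have -> : s * Y b = Y b / c * (s * c) by field.
exact: expR_chord.
Qed.

Variables (n : nat) (mu Y : 'I_n -> U -> R).
Hypothesis n_gt0 : (0 < n)%N.
Hypothesis mu_ge0 : forall j b, 0 <= mu j b.
Hypothesis mu_sum1 : forall j, \sum_b mu j b = 1.
Hypothesis Yc : forall j b, 0 <= Y j b <= c.

(** Chernoff's method: the indicator of the tail is at most exp (s (sum Y - m - t)), whose mean
    factors over the coordinates. *)
Lemma hoeffding_upper (t : R) : 0 <= t ->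
  \sum_(w : {ffun 'I_n -> U} |
        \sum_j \sum_b mu j b * Y j b + t <= \sum_j Y j (w j))
     \prod_j mu j (w j)
  <= expR (- (2 * t ^+ 2 / (n%:R * c ^+ 2))).
Proof.
move=> t0; set m := \sum_j _.
have nc0 : 0 < n%:R * c ^+ 2 by rewrite mulr_gt0 ?ltr0n ?exprn_gt0.
(* The minimiser of - s t + n (s c)^2 / 8. *)
pose s := 4 * t / (n%:R * c ^+ 2).
have s0 : 0 <= s by rewrite divr_ge0 ?(ltW nc0) ?mulr_ge0.
pose F (w : {ffun 'I_n -> U}) := \prod_j (mu j (w j) * expR (s * Y j (w j))).
have FE w : F w = (\prod_j mu j (w j)) * expR (s * \sum_j Y j (w j)).
  by rewrite /F big_split/= -expR_sum mulr_sumr.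
have p0 (w : {ffun 'I_n -> U}) : 0 <= \prod_j mu j (w j).
  by apply: prodr_ge0 => j _.
apply: (@le_trans _ _ (expR (- (s * (m + t))) * \sum_w F w)).
  rewrite mulr_sumr big_mkcond/=; apply: ler_sum => w _.
  rewrite FE mulrCA -expRD.
  case: ifPn => [mt|_]; last by rewrite mulr_ge0 ?expR_ge0.
  rewrite ler_peMr// -expR0 ler_expR addrC -mulrBr mulr_ge0//.
  by rewrite subr_ge0.
have -> : \sum_w F w = \prod_j \sum_b mu j b * expR (s * Y j b).
  by rewrite bigA_distr_bigA.
apply: (@le_trans _ _ (expR (- (s * (m + t))) *
  \prod_j expR (s * (\sum_b mu j b * Y j b) + (s * c) ^+ 2 / 8))).
  apply: ler_wpM2l; first exact: expR_ge0.
  apply: ler_prod => j _; rewrite sumr_ge0/= => [|b _].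
    exact: hoeffding_mgf.
  by rewrite mulr_ge0 ?expR_ge0.
rewrite -expR_sum -expRD ler_expR big_split/= -mulr_sumr -/m.
rewrite sumr_const card_ord /s -mulr_natl.
have -> // : forall x y : R, x = y -> x <= y by move=> x y ->.
by field; rewrite pnatr_eq0 gt_eqF//= gt_eqF.
Qed.

End Hoeffding.

(** The reflection [c - Y] has the same range and exchanges the two tails. *)
Lemma hoeffding_lower (R : realType) (U : finType) (c : R) (n : nat)
    (mu Y : 'I_n -> U -> R) (t : R) : 0 < c -> (0 < n)%N ->
  (forall j b, 0 <= mu j b) -> (forall j, \sum_b mu j b = 1) ->
  (forall j b, 0 <= Y j b <= c) -> 0 <= t ->
  \sum_(w : {ffun 'I_n -> U} |
        \sum_j Y j (w j) <= \sum_j \sum_b mu j b * Y j b - t)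
     \prod_j mu j (w j)
  <= expR (- (2 * t ^+ 2 / (n%:R * c ^+ 2))).
Proof.
move=> c0 n0 mu0 mu1 Yc t0.
have Y'c j b : 0 <= c - Y j b <= c.
  by have /andP[? ?] := Yc j b; rewrite subr_ge0 gerBl; apply/andP.
apply: le_trans (hoeffding_upper c0 n0 mu0 mu1 Y'c t0).
rewrite le_eqVlt; apply/orP; left; apply/eqP; apply: eq_bigl => w.
under [in RHS]eq_bigr => j _.
  under eq_bigr do rewrite mulrBr.
  rewrite sumrB -mulr_suml mu1 mul1r.
  over.
rewrite !sumrB; set a := \sum_j c.
by apply/idP/idP => ?; lra.
Qed.

(** * Rayleigh quotients of real symmetric matrices *)

Lemma continuous_sum (R : realType) (T : topologicalType) (I : finType)
    (f : I -> T -> R) :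
  (forall i, continuous (f i)) -> continuous (fun x => \sum_i f i x).
Proof.
move=> cf x; apply: cvg_big => [|i _]; first exact: add_continuous.
exact: cf.
Qed.

Section Rayleigh.
Variables (R : realType) (B : nat).
Implicit Types (A : 'M[R]_B) (u : 'rV[R]_B).

Definition qform A u : R := (u *m A *m u^T) 0 0.

Lemma qformE A u : qform A u = \sum_i \sum_k A i k * (u 0 i * u 0 k).
Proof.
rewrite /qform !mxE; under eq_bigr do rewrite !mxE mulr_suml.
rewrite exchange_big; apply: eq_bigr => i _; apply: eq_bigr => k _.
by rewrite mulrAC mulrC.
Qed.

Lemma qform1E u : qform 1%:M u = \sum_i u 0 i ^+ 2.
Proof.
by rewrite /qform mulmx1 mxE; apply: eq_bigr => i _; rewrite mxE expr2.
Qed.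

Lemma qformZ A a u : qform A (a *: u) = a ^+ 2 * qform A u.
Proof.
by rewrite /qform linearZ/= -!scalemxAl -scalemxAr !mxE mulrA expr2.
Qed.

Lemma qformN A u : qform (- A) u = - qform A u.
Proof. by rewrite /qform mulmxN mulNmx mxE. Qed.

Lemma qform_eigen A a u : u *m A = a *: u -> qform A u = a * qform 1%:M u.
Proof. by rewrite /qform mulmx1 => ->; rewrite -scalemxAl mxE. Qed.

Lemma qform1_ge0 u : 0 <= qform 1%:M u.
Proof. by rewrite qform1E; apply: sumr_ge0 => i _; exact: sqr_ge0. Qed.

Lemma qform1_gt0 u : u != 0 -> 0 < qform 1%:M u.
Proof.
move=> u0; rewrite lt_neqAle qform1_ge0 andbT eq_sym; apply: contraNneq u0.
rewrite qform1E => /psumr_eq0P u0; apply/eqP/rowP => i; rewrite mxE.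
by apply/eqP; rewrite -sqrf_eq0 u0// => k _; exact: sqr_ge0.
Qed.

Lemma qform_continuous A : continuous (qform A).
Proof.
have -> : qform A = fun u => \sum_i \sum_k A i k * (u 0 i * u 0 k).
  by apply/funext => u; exact: qformE.
apply: continuous_sum => i; apply: continuous_sum => k u.
have ci (l : 'I_B) : {for u, continuous (fun v : 'rV[R]_B => v 0 l)}.
  exact: coord_continuous.
have ca := @cst_continuous _ _ (A i k) u.
exact: (continuousM ca (continuousM (ci i) (ci k))).
Qed.

Lemma psd_qform_eq0 A u : A^T = A -> (forall v, 0 <= qform A v) ->
  qform A u = 0 -> u *m A = 0.
Proof.
move=> symA psd Au0; apply/eqP; apply: contraT => z0.
set z := u *m A in z0.
have zz0 := qform1_gt0 z0; set s := qform 1%:M z in zz0.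
have q0 := psd z; set q := qform A z in q0.
(* Moving from u in the direction -z would make the form negative. *)
have expand a : qform A (u + a *: z) = 2 * a * s + a ^+ 2 * q.
  have zE : z *m A *m u^T = z *m z^T.
    by rewrite /z -mulmxA trmx_mul symA.
  have uu : u *m A *m u^T = 0.
    by apply/matrixP => i k; rewrite !ord1 [LHS]Au0 mxE.
  have -> : qform A (u + a *: z) =
      ((2 * a) *: (z *m z^T) + a ^+ 2 *: (z *m A *m z^T)) 0 0.
    rewrite /qform; congr (fun_of_matrix _ 0 0).
    rewrite linearD linearZ/= !mulmxDr !mulmxDl -/z -!scalemxAr -!scalemxAl.
    by rewrite zE uu !add0r scalerA addrA -scalerDl mulr_natl mulr2n expr2.
  by rewrite /s /q /qform mulmx1 !mxE.
(* The quadratic in a is smallest at - s / q; using q + 1 avoids a zero denominator and still gives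
   a negative value. *)
have := psd (u + (- (s / (q + 1))) *: z); rewrite expand.
have q1 : q + 1 != 0 by rewrite gt_eqF// ltr_wpDl.
have -> : 2 * - (s / (q + 1)) * s + (- (s / (q + 1))) ^+ 2 * q =
    - (s ^+ 2 * (q + 2) / (q + 1) ^+ 2) by field.
by rewrite oppr_ge0 leNgt divr_gt0 ?mulr_gt0 ?exprn_gt0 ?ltr_wpDl.
Qed.

(** The form attains a minimum m at some v on the compact unit sphere. By homogeneity A - m I is
    positive semidefinite, and its form vanishes at v, so v lies in its kernel. *)
Lemma rayleigh_min A : (0 < B)%N -> A^T = A ->
  exists2 m, eigenvalue A m & forall u, m * qform 1%:M u <= qform A u.
Proof.
move=> B0 symA.
pose S : set 'rV[R]_B := [set u | qform 1%:M u = 1].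
have S0 : S !=set0.
  exists (delta_mx 0 (Ordinal B0)); rewrite /S/= qform1E.
  rewrite (bigD1 (Ordinal B0))//= mxE !eqxx expr1n big1 ?addr0// => i i0.
  by rewrite mxE (negPf i0) andbF expr0n.
have cS : compact S.
  apply: (@subclosed_compact _ _
    [set v : 'rV[R]_B | forall i, `[-1, 1]%classic (v ord0 i)]).
  - have -> : S = qform 1%:M @^-1` [set 1] by [].
    apply: closed_comp => [u _|]; first exact: qform_continuous.
    exact: closed_eq.
  - apply: (@rV_compact R B (fun=> `[-1, 1]%classic)) => i.
    exact: segment_compact.
  - move=> u; rewrite /S/= qform1E => u1 i; rewrite in_itv/= -ler_norml.
    rewrite -(@ler_pXn2r _ 2) ?nnegrE// expr1n real_normK ?num_real// -u1.
    by rewrite (bigD1 i)//= lerDl; apply: sumr_ge0 => k _; exact: sqr_ge0.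
have [v vS vmin] := compact_EVT_min S0 cS
  (continuous_subspaceT (@qform_continuous A)).
move: vS; rewrite inE /S/= => v1.
pose m := qform A v.
have mq u : m * qform 1%:M u <= qform A u.
  have [->|u0] := eqVneq u 0.
    by rewrite -(scale0r 0) !qformZ expr0n !mul0r mulr0.
  have su := qform1_gt0 u0; set s := qform 1%:M u in su *.
  have := vmin ((Num.sqrt s)^-1 *: u); rewrite inE /S/= !qformZ exprVn.
  rewrite sqr_sqrtr ?(ltW su)// -/s mulVf ?gt_eqF// => /(_ erefl).
  by rewrite -/m ler_pdivlMl// mulrC.
exists m => //; apply/eigenvalueP; exists v; last first.
  apply: contra_eq_neq v1 => ->.
  by rewrite -(scale0r 0) qformZ expr0n mul0r eq_sym oner_eq0.
have qE u : qform (A - m%:M) u = qform A u - m * qform 1%:M u.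
  by rewrite /qform mulmxBr mulmxBl mul_mx_scalar -scalemxAl mulmx1 !mxE.
have : v *m (A - m%:M) = 0.
  apply: psd_qform_eq0.
  - by rewrite linearB/= symA tr_scalar_mx.
  - by move=> u; rewrite qE subr_ge0.
  - by rewrite qE v1 mulr1 subrr.
by rewrite mulmxBr mul_mx_scalar => /subr0_eq.
Qed.

Lemma eigenvalueN A a : eigenvalue (- A) (- a) = eigenvalue A a.
Proof.
apply/eigenvalueP/eigenvalueP => -[v vA v0]; exists v => //.
  by apply: oppr_inj; rewrite -mulmxN vA scaleNr.
by rewrite mulmxN vA scaleNr.
Qed.

Lemma lambda_min_le_qform A u : (0 < B)%N -> A^T = A ->
  lambda_min A * qform 1%:M u <= qform A u.
Proof.
move=> B0 symA; have [m eigm mq] := rayleigh_min B0 symA.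
apply: le_trans (mq u); apply: ler_wpM2r; first exact: qform1_ge0.
(* [inf] is a lower bound only for a set bounded below; testing the Rayleigh bound on eigenvectors
   shows that m bounds all eigenvalues. *)
apply: ge_inf => //; exists m => a /= /eigenvalueP[v vA v0].
have := mq v; rewrite (qform_eigen vA) ler_pM2r//; exact: qform1_gt0.
Qed.

(** The lower bound for [- A], whose eigenvalues are the opposites of those of [A]. *)
Lemma qform_le_lambda_max A u : (0 < B)%N -> A^T = A ->
  qform A u <= lambda_max A * qform 1%:M u.
Proof.
move=> B0 symA.
have symNA : (- A)^T = - A by rewrite linearN/= symA.
have := lambda_min_le_qform u B0 symNA; rewrite qformN /lambda_min /inf.
rewrite mulNr lerN2 /lambda_max; congr (_ <= sup _ * _).
apply/seteqP; split => [_ /= [a eiga <-]|a /= eiga].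
  by rewrite -eigenvalueN opprK.
by exists (- a); rewrite ?opprK// eigenvalueN.
Qed.

Lemma lambda_min_le_max A : (0 < B)%N -> A^T = A ->
  lambda_min A <= lambda_max A.
Proof.
move=> B0 symA; pose u : 'rV[R]_B := const_mx 1.
have u0 : u != 0.
  apply/eqP => /rowP/(_ (Ordinal B0)); rewrite !mxE => /eqP.
  by rewrite oner_eq0.
rewrite -(ler_pM2r (qform1_gt0 u0)).
exact: le_trans (lambda_min_le_qform u B0 symA) (qform_le_lambda_max u B0 symA).
Qed.

End Rayleigh.

(** * Second moments of a binary Markov chain *)

Definition mass (R : realType) (U : finType) (nu : U -> R) (A : pred U) : R :=
  \sum_(u | A u) nu u.

Section SecondMoment.
Variables (R : realType) (B : nat) (nu : {ffun 'I_B -> bool} -> R).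
Variables (q0 q1 p : R).

Local Notation pr := (mass nu).

(** The counterpart of [past] on the finite space of trajectories. *)
Definition agree_upto (i : 'I_B) (a c : {ffun 'I_B -> bool}) :=
  [forall l : 'I_B, (l <= i)%N ==> (c l == a l)].

Hypothesis step : forall (i k : 'I_B) a, k = i.+1 :> nat ->
  pr [pred c : {ffun 'I_B -> bool} | c k & agree_upto i a c] =
  (if a i then 1 - q1 else q0) * pr (agree_upto i a).
Hypothesis marginal : forall i, pr [pred c : {ffun 'I_B -> bool} | c i] = p.
Hypothesis p_invariant : p * (q0 + q1) = q0.

(** The transition factor depends on the past only through the state at time [i], so it comes out of
    the sum over all pasts with that state. *)
Lemma pr_step (i0 i k : 'I_B) (b : bool) : (i0 <= i)%N -> k = i.+1 :> nat ->
  pr [pred c : {ffun 'I_B -> bool} | [&& c i0, c i == b & c k]] =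
  (if b then 1 - q1 else q0) *
  pr [pred c : {ffun 'I_B -> bool} | c i0 && (c i == b)].
Proof.
move=> i0i ki.
(* Partition by the past up to time i; [tr c] is its canonical extension. *)
pose tr (c : {ffun 'I_B -> bool}) : {ffun 'I_B -> bool} :=
  [ffun l : 'I_B => (l <= i)%N && c l].
have trE a c : (tr c == a) = (tr a == a) && agree_upto i a c.
  apply/eqP/andP => [<-|[/eqP <- /forallP ac]].
    split; first by apply/eqP/ffunP => l; rewrite !ffunE; case: leqP.
    by apply/forallP => l; apply/implyP => li; rewrite ffunE li.
  apply/ffunP => l; rewrite !ffunE; case: leqP => //= li.
  by have := ac l; rewrite li ffunE li => /eqP.
rewrite /mass (partition_big tr predT)//=.
rewrite [X in _ = _ * X](partition_big tr predT)//=.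
rewrite mulr_sumr; apply: eq_bigr => a _.
(* For a non-canonical [a], or one violating a constraint, the cells on both sides are empty. *)
have [aE|aN] := boolP [&& tr a == a, a i0 & a i == b]; last first.
  rewrite !big1 ?mulr0// => c; rewrite trE => /and3P[/andP[ci0 cib] ta /forallP ac].
    exfalso; move: aN; rewrite ta; have /eqP <- := implyP (ac i0) i0i.
    by have /eqP <- := implyP (ac i) (leqnn i); rewrite ci0 cib.
  exfalso; move: aN; rewrite ta; have /eqP <- := implyP (ac i0) i0i.
  have /eqP <- := implyP (ac i) (leqnn i); rewrite ci0.
  by case/andP: cib => ->.
have /and3P[ta ai0 /eqP aib] := aE.
have agi c : agree_upto i a c -> c i0 && (c i == b).
  move=> /forallP ac; have /eqP -> := implyP (ac i0) i0i.
  by have /eqP -> := implyP (ac i) (leqnn i); rewrite ai0 aib eqxx.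
transitivity (pr [pred c : {ffun 'I_B -> bool} | c k & agree_upto i a c]).
  apply: eq_bigl => c /=; rewrite trE ta /=.
  have [ac|] := boolP (agree_upto i a c); last by rewrite !andbF.
  by have /andP[-> ->] := agi _ ac; rewrite !andbT.
rewrite step// aib; congr (_ * _); apply: eq_bigl => c /=; rewrite trE ta /=.
have [ac|] := boolP (agree_upto i a c); last by rewrite andbF.
by have /andP[-> ->] := agi _ ac.
Qed.

Lemma pr_split (A D : pred {ffun 'I_B -> bool}) :
  pr A = pr [pred c | A c && D c] + pr [pred c | A c && ~~ D c].
Proof. by rewrite /mass (bigID D). Qed.

(** Induction on the gap. Conditioning on the state just before [k] gives J' = (1 - q1) J + q0 (p -
    J) = alpha J + p q0, whose fixed point is p^2 by invariance of [p]; the deviation from it starts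
    at p (1 - p) and is multiplied by alpha at each step. *)
Lemma joint_marginal (i k : 'I_B) : (i <= k)%N ->
  pr [pred c : {ffun 'I_B -> bool} | c i && c k] =
  p ^+ 2 + p * (1 - p) * (1 - q0 - q1) ^+ (k - i).
Proof.
move=> ik; have [d dE] : exists d, k = (i + d)%N :> nat.
  by exists (k - i)%N; rewrite subnKC.
rewrite dE addKn; elim: d k {ik} dE => [|d IH] k dE.
  have -> : k = i by apply: val_inj; rewrite /= dE addn0.
  transitivity p; last by ring.
  by rewrite -(marginal i); apply: eq_bigl => c /=; rewrite andbb.
have ltB : (i + d < B)%N by apply: leq_trans (ltn_ord k); rewrite dE addnS.
pose k' := Ordinal ltB.
have {}IH := IH k' erefl.
have kS : k = k'.+1 :> nat by rewrite dE addnS.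
have ik' : (i <= k')%N by rewrite leq_addr.
rewrite (pr_split _ [pred c : {ffun 'I_B -> bool} | c k']).
have := pr_step true ik' kS; have := pr_step false ik' kS.
have := pr_split [pred c : {ffun 'I_B -> bool} | c i]
  [pred c : {ffun 'I_B -> bool} | c k'].
rewrite marginal IH.
set J1 := pr [pred c | _ && ~~ _] => J1E.
have -> : pr [pred c : {ffun 'I_B -> bool} | c i && (c k' == false)] = J1.
  by apply: eq_bigl => c /=; rewrite eqbF_neg.
have -> : pr [pred c : {ffun 'I_B -> bool} | c i && (c k' == true)] =
    p ^+ 2 + p * (1 - p) * (1 - q0 - q1) ^+ d.
  by rewrite -IH; apply: eq_bigl => c /=; rewrite eqb_id.
move=> e0 e1.
have -> : pr [pred c | [pred c0 : {ffun 'I_B -> bool} | c0 i && c0 k] c &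
    [pred c0 : {ffun 'I_B -> bool} | c0 k'] c] =
    pr [pred c : {ffun 'I_B -> bool} | [&& c i, c k' == true & c k]].
  by apply: eq_bigl => c /=; rewrite eqb_id -andbA (andbC (c k)).
have -> : pr [pred c | [pred c0 : {ffun 'I_B -> bool} | c0 i && c0 k] c &
    ~~ [pred c0 : {ffun 'I_B -> bool} | c0 k'] c] =
    pr [pred c : {ffun 'I_B -> bool} | [&& c i, c k' == false & c k]].
  by apply: eq_bigl => c /=; rewrite eqbF_neg -andbA (andbC (c k)).
rewrite e0 e1 [_ ^+ d.+1]exprS.
have {}J1E : J1 = p - (p ^+ 2 + p * (1 - p) * (1 - q0 - q1) ^+ d).
  by rewrite [X in X - _]J1E addrAC subrr add0r.
rewrite J1E; set z := _ ^+ d.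
(* Invariance enters only in the term q0 p; once it is rewritten there, a polynomial identity
   remains. *)
have -> : q0 * (p - (p ^+ 2 + p * (1 - p) * z)) =
  p * (q0 + q1) * p - q0 * (p ^+ 2 + p * (1 - p) * z).
  by rewrite p_invariant; ring.
by ring.
Qed.

Lemma second_moment (u : 'rV[R]_B) :
  \sum_c nu c * (\sum_i (c i)%:R * u 0 i) ^+ 2 =
  p ^+ 2 * (\sum_i u 0 i) ^+ 2 +
  p * (1 - p) * qform (Lambda B (1 - q0 - q1)) u.
Proof.
transitivity (\sum_i \sum_k pr [pred c : {ffun 'I_B -> bool} | c i && c k] *
    (u 0 i * u 0 k)).
  under eq_bigr => c _.
    rewrite expr2 mulr_suml mulr_sumr.
    under eq_bigr do rewrite mulr_sumr mulr_sumr.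
    over.
  rewrite exchange_big/=; apply: eq_bigr => i _.
  rewrite exchange_big/=; apply: eq_bigr => k _.
  rewrite /mass mulr_suml [RHS]big_mkcond/=; apply: eq_bigr => c _.
  by case: (c i); case: (c k); rewrite /= ?mul0r ?mulr0 ?mul1r.
have joint i k : pr [pred c : {ffun 'I_B -> bool} | c i && c k] =
    p ^+ 2 + p * (1 - p) * Lambda B (1 - q0 - q1) i k.
  rewrite mxE; have [ik|ki] := leqP i k.
    by rewrite joint_marginal// distnC distnEl.
  rewrite distnEl ?(ltnW ki)// -joint_marginal ?(ltnW ki)//.
  by apply: eq_bigl => c /=; rewrite andbC.
under eq_bigr do under eq_bigr do rewrite joint mulrDl -[in X in _ + X]mulrA.
under eq_bigr do rewrite big_split/= -!mulr_sumr.
rewrite big_split/= -!mulr_sumr qformE; congr (_ * _ + _).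
by rewrite expr2 mulr_suml; apply: eq_bigr => i _; rewrite mulr_sumr.
Qed.

End SecondMoment.

(** * Laws of finite-valued random variables *)

Section FiniteValued.
Context {dT : measure_display} {T : measurableType dT} {R : realType}.
Variable P : probability T R.

Definition finite_law (U : Type) (W : T -> U) (u : U) : R :=
  fine (P (W @^-1` [set u])).

Lemma finite_law_ge0 (U : Type) (W : T -> U) u : 0 <= finite_law W u.
Proof. by rewrite fine_ge0. Qed.

Lemma measurable_fiber_ffun (I U : finType) (X : I -> T -> U) :
  (forall i u, measurable (X i @^-1` [set u])) ->
  forall v, measurable ((fun w => [ffun i => X i w]) @^-1` [set v]).
Proof.
move=> mX v.
have -> : (fun w => [ffun i => X i w]) @^-1` [set v] =
    \bigcap_(i in [set: I]) X i @^-1` [set v i].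
  apply/seteqP; split => w /=.
    by move=> <- i _; rewrite /= ffunE.
  by move=> Xv; apply/ffunP => i; rewrite ffunE Xv.
by apply: fin_bigcap_measurable => [|i _]; [exact: finite_finset|exact: mX].
Qed.

Variables (U : finType) (W : T -> U).
Hypothesis mW : forall u, measurable (W @^-1` [set u]).

Lemma finite_valued_eventE (A : pred U) :
  [set w | A (W w)] = \bigcup_(u in [set` enum A]) W @^-1` [set u].
Proof.
apply/seteqP; split => [w Aw|w [u /= uA Wu]]; last first.
  by move: uA; rewrite mem_enum -Wu.
by exists (W w) => //=; rewrite mem_enum.
Qed.

Lemma measurable_finite_valued (A : pred U) : measurable [set w | A (W w)].
Proof.
rewrite finite_valued_eventE.
by apply: fin_bigcup_measurable => // u _; exact: mW.
Qed.

(** The fibres of [W] are measurable and disjoint, so additivity turns the probability of any event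
    read off [W] into a finite sum. *)
Lemma prob_finite_valued (A : pred U) :
  P [set w | A (W w)] = (\sum_(u | A u) finite_law W u)%:E.
Proof.
rewrite finite_valued_eventE measure_fin_bigcup//; last first.
  apply/trivIsetP => u v _ _ /eqP uv; apply/seteqP; split => // w /= [Wu Wv].
  by apply: uv; rewrite -Wu -Wv.
rewrite -fsbig_seq ?enum_uniq// big_enum_cond/= -sumEFin big_mkcondr/=.
by apply: eq_big => [u|u _]; rewrite ?andbT// fineK// fin_num_measure.
Qed.

Lemma finite_law_sum1 : \sum_u finite_law W u = 1.
Proof.
apply: EFin_inj; rewrite -prob_finite_valued -(probability_setT P).
by congr (P _); apply/seteqP.
Qed.

End FiniteValued.

(** * One-step rules for the law of a Markov trajectory *)

Section MarkovLaw.
Context {dT : measure_display} {T : measurableType dT} {R : realType}.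
Variables (P : probability T R) (B : nat) (X : 'I_B -> T -> bool).
Variables (q0 q1 p : R).
Hypothesis mX : forall i b, measurable (X i @^-1` [set b]).
Hypothesis markovX : markov1 P X.
Hypothesis trans0 : transition P X false true q0.
Hypothesis trans1 : transition P X true false q1.
Hypothesis marginalX : forall i, P [set w | X i w = true] = p%:E.
Hypothesis p01 : 0 < p < 1.

Local Notation V := (fun w => [ffun i => X i w]).
Local Notation pr := (mass (finite_law P V)).

Lemma mass_finite_law (A : pred {ffun 'I_B -> bool}) E :
  (forall w, E w <-> A (V w)) ->
  fine (P E) = pr A.
Proof.
move=> EA; have -> : E = [set w | A (V w)] by apply/seteqP; split => w /EA.
by rewrite (prob_finite_valued P (measurable_fiber_ffun mX)).
Qed.

Lemma finite_law_marginal i : pr [pred c : {ffun 'I_B -> bool} | c i] = p.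
Proof.
rewrite -(mass_finite_law (E := [set w | X i w = true])) ?marginalX// => w.
by rewrite /= ffunE.
Qed.

(** Staying at 1 is complementary to the jump of probability [q1]; the two conditional probabilities
    sum to 1 because the conditioning event has mass p, which is nonzero. *)
Lemma finite_law_transition (i k : 'I_B) (b : bool) : k = i.+1 :> nat ->
  cprob P [set w | X k w = true] [set w | X i w = b] =
  if b then 1 - q1 else q0.
Proof.
move=> ki; case: b; last exact: trans0.
have := trans1 ki; rewrite /cprob marginalX/=.
have /andP[p0 _] := p01; have pn0 : p != 0 by rewrite gt_eqF.
rewrite (mass_finite_law
  (A := [pred c : {ffun 'I_B -> bool} | c i && ~~ c k])); last first.
  move=> w; rewrite /= !ffunE.
  by case: (X i w); case: (X k w); split => // -[].
rewrite (mass_finite_law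
  (A := [pred c : {ffun 'I_B -> bool} | c i && c k])); last first.
  move=> w; rewrite /= !ffunE.
  by case: (X i w); case: (X k w); split => // -[].
move=> <-; apply: (mulIf pn0); rewrite mulrBl !divfK// mul1r.
rewrite -[in RHS](finite_law_marginal i) /mass.
rewrite [X in X - _](bigID [pred c : {ffun 'I_B -> bool} | c k])/=.
by rewrite addrK.
Qed.

(** The product form also covers pasts of probability zero, where [markov1] is silent and both sides
    vanish by monotonicity. *)
Lemma finite_law_step (i k : 'I_B) (a : {ffun 'I_B -> bool}) : k = i.+1 :> nat ->
  pr [pred c : {ffun 'I_B -> bool} | c k & agree_upto i a c] =
  (if a i then 1 - q1 else q0) * pr (agree_upto i a).
Proof.
move=> ki; have pastE w : past X i a w <-> agree_upto i a (V w).
  split=> [pw|/forallP pw l li].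
    by apply/forallP => l; apply/implyP => li; rewrite ffunE pw.
  by have := pw l; rewrite li ffunE => /eqP.
have [Z|NZ] := eqVneq (pr (agree_upto i a)) 0.
  rewrite Z mulr0; apply/eqP; rewrite eq_le; apply/andP; split; last first.
    by apply: sumr_ge0 => c _; exact: finite_law_ge0.
  rewrite -Z /mass [leRHS](bigID [pred c : {ffun 'I_B -> bool} | c k])/=.
  rewrite (eq_bigl (fun c => agree_upto i a c && c k)) => [|c]; last exact: andbC.
  by rewrite lerDl; apply: sumr_ge0 => c _; exact: finite_law_ge0.
have Pn0 : P (past X i a) != 0%E.
  by apply: contra_neq NZ; rewrite -(mass_finite_law pastE) => ->.
have := markovX true ki Pn0; rewrite finite_law_transition// => <-.
rewrite /cprob (mass_finite_law pastE) divfK//; apply/esym/mass_finite_law => w.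
by rewrite /= ffunE; split => [[-> /pastE]//|/andP[-> /pastE]].
Qed.

End MarkovLaw.

(** * Energy of a masked signal and its mean *)

Section Energy.
Variables (R : realType) (B n : nat).
Implicit Types z x c : 'rV[R]_(B * n).

(** The values of coordinate [j] across all frames, which are masked by a single Markov chain. *)
Definition pixel z (j : 'I_n) : 'rV[R]_B := \row_i vec_mx z i j.

Lemma sum_pixel z (F : R -> R) :
  \sum_k F (z 0 k) = \sum_j \sum_i F (pixel z j 0 i).
Proof.
rewrite exchange_big/= pair_big/= (reindex _ (curry_mxvec_bij _ _))/=.
by apply: eq_bigr => -[i j] _; rewrite /= !mxE.
Qed.

Lemma l2sq_pixel z : l2sq z = \sum_j qform 1%:M (pixel z j).
Proof.
rewrite /l2sq big_ord1 (sum_pixel z (fun a => a ^+ 2)).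
by apply: eq_bigr => j _; rewrite qform1E.
Qed.

Lemma l2sq_ge0 m k (A : 'M[R]_(m, k)) : 0 <= l2sq A.
Proof.
by apply: sumr_ge0 => i _; apply: sumr_ge0 => j _; exact: sqr_ge0.
Qed.

Lemma l2sq_le_const z (b : R) : (forall k, `|z 0 k| <= b) ->
  l2sq z <= (B * n)%:R * b ^+ 2.
Proof.
move=> zb; rewrite /l2sq big_ord1 mulr_natl -[X in _ *+ X]card_ord -sumr_const.
apply: ler_sum => k _; rewrite -real_normK ?num_real//.
by rewrite lerXn2r ?nnegrE ?(le_trans _ (zb k))//.
Qed.

Lemma measurementB d x c :
  measurement d (x - c) = measurement d x - measurement d c.
Proof.
rewrite /measurement -sumrB; apply: eq_bigr => i _.
by rewrite /frame !linearB.
Qed.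

(** The squared [j]-th coordinate of the measurement when the [j]-th chain follows the trajectory
    [a]. *)
Definition energy z (j : 'I_n) (a : {ffun 'I_B -> bool}) : R :=
  (\sum_i (a i)%:R * pixel z j 0 i) ^+ 2.

Lemma l2sq_measurement (d : 'I_n -> {ffun 'I_B -> bool}) z :
  l2sq (measurement (fun i j => d j i) z) = \sum_j energy z j (d j).
Proof.
rewrite /l2sq; apply: eq_bigr => j _; rewrite big_ord1 /energy; congr (_ ^+ 2).
rewrite /measurement summxE; apply: eq_bigr => i _.
by rewrite /mask mul_diag_mx !mxE.
Qed.

Lemma energy_bound z (b : R) j a : (forall k, `|z 0 k| <= b) ->
  0 <= energy z j a <= (B%:R * b) ^+ 2.
Proof.
move=> zb; rewrite sqr_ge0/= -[leLHS]real_normK ?num_real//.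
have le_sum : `|\sum_i (a i)%:R * pixel z j 0 i| <= B%:R * b.
  apply: le_trans (ler_norm_sum _ _ _) _.
  rewrite mulr_natl -[X in _ *+ X]card_ord -sumr_const.
  apply: ler_sum => i _; rewrite normrM normr_nat !mxE.
  apply: le_trans (zb (mxvec_index i j)).
  by case: (a i); rewrite ?mul1r// mul0r.
by rewrite lerXn2r ?nnegrE ?(le_trans _ le_sum)//.
Qed.

(** Cauchy-Schwarz against the all-ones vector, read off from the nonnegative sum of squared
    deviations from the average [s]. *)
Lemma sqr_sum_le (u : 'rV[R]_B) : (\sum_i u 0 i) ^+ 2 <= B%:R * qform 1%:M u.
Proof.
have [B0|B0] := posnP B.
  rewrite big1 ?expr0n ?mulr_ge0 ?qform1_ge0// => i.
  by have := ltn_ord i; rewrite [X in (_ < X)%N]B0.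
have Bn0 : B%:R != 0 :> R by rewrite pnatr_eq0 -lt0n.
pose s := (\sum_i u 0 i) / B%:R.
have : 0 <= \sum_i (u 0 i - s) ^+ 2 by apply: sumr_ge0 => i _; exact: sqr_ge0.
under eq_bigr do rewrite sqrrB.
rewrite big_split/= sumrB sumrMnl -mulr_suml -qform1E sumr_const card_ord.
have -> : qform 1%:M u - (\sum_i u 0 i) * s *+ 2 + s ^+ 2 *+ B =
    qform 1%:M u - (\sum_i u 0 i) ^+ 2 / B%:R.
  by rewrite -mulr_natr -[s ^+ 2 *+ B]mulr_natr /s; field.
by rewrite subr_ge0 ler_pdivrMr ?ltr0n// mulrC.
Qed.

Variables (nu : 'I_n -> {ffun 'I_B -> bool} -> R) (q0 q1 p : R).
Hypothesis B_gt0 : (0 < B)%N.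
Hypothesis step : forall (j : 'I_n) (i k : 'I_B) (a : {ffun 'I_B -> bool}),
  k = i.+1 :> nat ->
  mass (nu j) [pred c : {ffun 'I_B -> bool} | c k & agree_upto i a c] =
  (if a i then 1 - q1 else q0) * mass (nu j) (agree_upto i a).
Hypothesis marginal : forall j i,
  mass (nu j) [pred c : {ffun 'I_B -> bool} | c i] = p.
Hypothesis p_invariant : p * (q0 + q1) = q0.
Hypothesis p01 : 0 < p < 1.

Local Notation L := (Lambda B (1 - q0 - q1)).

Lemma Lambda_sym : L^T = L.
Proof. by apply/matrixP => i k; rewrite !mxE distnC. Qed.

Lemma mean_energyE z :
  \sum_j \sum_a nu j a * energy z j a =
  \sum_j (p ^+ 2 * (\sum_i pixel z j 0 i) ^+ 2 +
          p * (1 - p) * qform L (pixel z j)).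
Proof.
apply: eq_bigr => j _.
exact: (second_moment (@step j) (@marginal j) p_invariant).
Qed.

(** The squared-sum term is dropped and the smallest eigenvalue bounds the rest. *)
Lemma mean_energy_ge z :
  p * (1 - p) * lambda_min L * l2sq z <= \sum_j \sum_a nu j a * energy z j a.
Proof.
have /andP[p0 p1] := p01.
have pp : 0 < p * (1 - p) by rewrite mulr_gt0 ?subr_gt0.
rewrite mean_energyE l2sq_pixel mulr_sumr; apply: ler_sum => j _.
rewrite -mulrA -[leLHS]add0r; apply: lerD.
  by rewrite mulr_ge0 ?sqr_ge0.
rewrite ler_pM2l//; exact: lambda_min_le_qform Lambda_sym.
Qed.

Lemma mean_energy_le z :
  \sum_j \sum_a nu j a * energy z j a <=
  (p ^+ 2 * B%:R + p * (1 - p) * lambda_max L) * l2sq z.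
Proof.
have /andP[p0 p1] := p01.
have pp : 0 < p * (1 - p) by rewrite mulr_gt0 ?subr_gt0.
rewrite mean_energyE l2sq_pixel mulr_sumr; apply: ler_sum => j _.
rewrite mulrDl -[X in _ <= X + _]mulrA -[X in _ <= _ + X]mulrA; apply: lerD.
  by rewrite ler_wpM2l ?sqr_ge0 ?sqr_sum_le.
rewrite ler_pM2l//; exact: qform_le_lambda_max Lambda_sym.
Qed.

End Energy.

(** * Union bound and the deviation exponent *)

Lemma union_bound (R : realType) (Omega : finType) (mu : Omega -> R) (K : nat)
    (bad : 'I_K -> pred Omega) (G : pred Omega) (e : R) :
  (forall w, 0 <= mu w) -> \sum_w mu w = 1 ->
  (forall m, mass mu (bad m) <= e) ->
  (forall w, (forall m, ~~ bad m w) -> G w) ->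
  1 - K%:R * e <= mass mu G.
Proof.
move=> mu0 mu1 bade goodG; rewrite lerBlDr.
have le_bad : \sum_m mass mu (bad m) <= K%:R * e.
  rewrite mulr_natl -[X in _ *+ X]card_ord -sumr_const.
  by apply: ler_sum => m _; exact: bade.
apply: le_trans (lerD (lexx _) le_bad).
rewrite -mu1 [leLHS](bigID G)/=; apply: lerD => //.
(* After the exchange, each point outside [G] is counted once for every bad event containing it,
   hence at least once. *)
rewrite /mass (exchange_big_dep predT)//= big_mkcond/=.
apply: ler_sum => w _; case: ifPn => [Gw|_]; last by rewrite sumr_ge0.
have [m bm] : exists m, bad m w.
  apply/existsP; apply: contraT; rewrite negb_exists => /forallP nb.
  by move: Gw; rewrite goodG.
by rewrite (bigD1 m)//= lerDl sumr_ge0.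
Qed.

Lemma deviation_exponent (R : realType) (n B : nat) (b eps : R) :
  (0 < n)%N -> (0 < B)%N -> 0 < b ->
  2 * ((n * B)%:R * b ^+ 2 * eps / 2) ^+ 2 / (n%:R * ((B%:R * b) ^+ 2) ^+ 2) =
  n%:R * eps ^+ 2 / (2 * B%:R ^+ 2).
Proof.
move=> n0 B0 b0; rewrite natrM.
by field; rewrite !pnatr_eq0 -!lt0n n0 B0 gt_eqF.
Qed.

(** * The recovery bound *)

Unset Implicit Arguments.

Theorem theorem3 (R : realType) (n B : nat) (hn : (1 <= n)%N) (hB : (1 <= B)%N)
    (rho : R) (hrho : 0 < rho)
    (Q : set 'rV[R]_(B * n)) (hQ : compact Q)
    (hQrho : forall x, Q x -> forall k, `|x 0 k| <= rho / 2)
    (r delta : R) (f : 'rV[R]_(B * n) -> nat) (g : nat -> 'rV[R]_(B * n))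
    (hf : encoder_of_rate Q r f)
    (hdelta : distortion Q f g = delta)
    (hC : forall c, codebook Q f g c -> forall k, `|c 0 k| <= rho / 2)
    (dT : measure_display) (T : measurableType dT) (P : probability T R)
    (D : 'I_B -> 'I_n -> {RV P >-> bool})
    (q0 q1 p : R) (hq0 : q0 <= 1 / 2) (hq1 : q1 <= 1 / 2)
    (hindep : mutually_independent P
                (fun (j : 'I_n) (w : T) => [ffun i : 'I_B => D i j w]))
    (hstat : forall j : 'I_n, stationary P (fun i => D i j))
    (hmarkov : forall j : 'I_n, markov1 P (fun i => D i j))
    (htrans0 : forall j : 'I_n, transition P (fun i => D i j) false true q0)
    (htrans1 : forall j : 'I_n, transition P (fun i => D i j) true false q1)
    (hpD : forall (i : 'I_B) (j : 'I_n), P [set w | D i j w = true] = p%:E)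
    (hp : p = q0 / (q0 + q1)) (hp01 : 0 < p < 1)
    (x : 'rV[R]_(B * n)) (hx : Q x)
    (eps : R) (heps : 0 < eps)
    (hmin : 0 < lambda_min (Lambda B (1 - q0 - q1))) :
  let lmax := lambda_max (Lambda B (1 - q0 - q1)) in
  let lmin := lambda_min (Lambda B (1 - q0 - q1)) in
  let C := codebook Q f g in
  let good : set T := [set w |
    let d := fun i j => D i j w in
    let y := measurement d x in
    forall xhat, is_solution C d y xhat ->
      l2sq (x - xhat) / (n * B)%:R <=
        (lmax * (1 - p) + p * B%:R) / (lmin * (1 - p)) * (delta / (n * B)%:R)
        + rho ^+ 2 * eps / (lmin * p * (1 - p))] in
  measurable good /\
  ((1 - 2 `^ (B%:R * r + 1) * expR (- (n%:R * eps ^+ 2 / (2 * B%:R ^+ 2))))%:E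
     < P good)%E.
Proof.
move=> lmax lmin C good.
have rho_ge0 := ltW hrho; have eps_ge0 := ltW heps.
have /andP[p0 p1] := hp01; have p1' : 0 < 1 - p by rewrite subr_gt0.
have p_inv : p * (q0 + q1) = q0.
  (* If q0 + q1 were 0, the convention for the inverse of 0 would give p = 0. *)
  rewrite hp divfK//; apply: contraTneq p0 => q01.
  by rewrite hp q01 invr0 mulr0 ltxx.
(* The masks are regrouped by pixel, so that the coordinates of [W] are independent and its law is a
   product. *)
pose V (j : 'I_n) (w : T) := [ffun i : 'I_B => D i j w].
pose W (w : T) := [ffun j : 'I_n => V j w].
have mD j i b : measurable (D i j @^-1` [set b]).
  by rewrite -[X in measurable X]setTI; exact: measurable_funP.
have mV j a : measurable (V j @^-1` [set a]).
  by apply: measurable_fiber_ffun => i b; exact: mD.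
have mW a : measurable (W @^-1` [set a]) by exact: measurable_fiber_ffun.
pose nu j := finite_law P (V j).
have nu0 j a : 0 <= nu j a by exact: finite_law_ge0.
have nu1 j : \sum_a nu j a = 1 by exact: finite_law_sum1.
have muE a : finite_law P W a = \prod_j nu j (a j).
  rewrite /finite_law; have -> : W @^-1` [set a] =
      [set w | forall j, V j w \in [set a j]%SET].
    apply/seteqP; split => w /= => [<- j|Va]; first by rewrite inE ffunE.
    by apply/ffunP => j; rewrite ffunE; have := Va j; rewrite inE => /eqP.
  rewrite hindep; apply: EFin_inj; rewrite (big_morph EFin (@EFinM _) erefl).
  rewrite (eq_bigr (fun j => (nu j (a j))%:E)); last first.
    move=> j _; rewrite fineK ?fin_num_measure//; congr (P _).
    by apply/seteqP; split => w /=; rewrite inE => /eqP.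
  by rewrite -(big_morph EFin (@EFinM _) erefl).
have step (j : 'I_n) (i k : 'I_B) (a : {ffun 'I_B -> bool}) : k = i.+1 :> nat ->
    mass (nu j) [pred c : {ffun 'I_B -> bool} | c k & agree_upto i a c] =
    (if a i then 1 - q1 else q0) * mass (nu j) (agree_upto i a).
  exact: (finite_law_step (@mD j) (hmarkov j) (htrans0 j) (htrans1 j)
    (hpD ^~ j) hp01).
have marginal j i : mass (nu j) [pred c : {ffun 'I_B -> bool} | c i] = p.
  exact: (finite_law_marginal (@mD j) (hpD ^~ j)).
(* Two deviations are paid, and 2 t divided by n B p (1 - p) lmin is the additive term of the
   bound. *)
pose t : R := (n * B)%:R * rho ^+ 2 * eps / 2.
have t0 : 0 <= t by rewrite /t divr_ge0 ?mulr_ge0 ?sqr_ge0.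
pose e : R := expR (- (n%:R * eps ^+ 2 / (2 * B%:R ^+ 2))).
have B0 : 0 < B%:R :> R by rewrite ltr0n.
have c0 : 0 < (B%:R * rho) ^+ 2 :> R by rewrite exprn_gt0 ?mulr_gt0.
pose mean z := \sum_j \sum_a nu j a * energy z j a.
pose err m := x - g m.
have err_le m : C (g m) -> forall k, `|err m 0 k| <= rho.
  move=> Cg k; rewrite !mxE [rho]splitr; apply: le_trans (ler_normB _ _) _.
  by apply: lerD; [exact: hQrho|exact: hC].
(* The number of messages, 2^(B r) rounded down; the ordinal m stands for the message [m.+1]. *)
pose N := Num.trunc (2 `^ (B%:R * r) : R).
(* One event per message: the lower tail for the message [f x] is dispensable,
   since its codeword is within delta of x.  This leaves at most 2^(B r) events
   and makes the final inequality strict. *)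
pose bad (m : 'I_N) : pred {ffun 'I_n -> {ffun 'I_B -> bool}} := fun w =>
  `[< C (g m.+1) >] &&
  (if m.+1 == f x then mean (err m.+1) + t <= \sum_j energy (err m.+1) j (w j)
   else \sum_j energy (err m.+1) j (w j) <= mean (err m.+1) - t).
(* Outside the codebook the entries of [g m.+1] have no known bound; the guard in [bad] makes the
   event empty there. *)
have bad_le m : mass (finite_law P W) (bad m) <= e.
  rewrite /mass /bad; have [/err_le errb|_] := asboolP (C (g m.+1)); last first.
    by rewrite big_pred0 ?expR_ge0.
  under eq_bigr do rewrite muE.
  have Yb j a := energy_bound j a errb.
  rewrite /e -(deviation_exponent eps hn hB hrho) -/t; case: eqP => _ /=.
    exact: hoeffding_upper.
  exact: hoeffding_lower.
pose G (w : {ffun 'I_n -> {ffun 'I_B -> bool}}) : bool :=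
  `[< forall xhat, is_solution C (fun i j => w j i)
        (measurement (fun i j => w j i) x) xhat ->
      l2sq (x - xhat) / (n * B)%:R <=
        (lmax * (1 - p) + p * B%:R) / (lmin * (1 - p)) * (delta / (n * B)%:R)
        + rho ^+ 2 * eps / (lmin * p * (1 - p)) >].
have goodE : good = [set w | G (W w)].
  have dE w : (fun i j => W w j i) = (fun i j => D i j w).
    by apply/funext => i; apply/funext => j; rewrite !ffunE.
  apply/seteqP; split => w; [move=> gw; apply/asboolP|move/asboolP];
    by rewrite dE.
rewrite goodE; split; first exact: measurable_finite_valued.
rewrite (prob_finite_valued P mW) lte_fin -/e.
have pow0 : 0 < 2 `^ (B%:R * r) :> R by rewrite powR_gt0.
apply: (@lt_le_trans _ _ (1 - N%:R * e)); last first.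
  apply: (union_bound (bad := bad)) => //.
  - by move=> w; exact: finite_law_ge0.
  - exact: finite_law_sum1.
  - move=> w nbad; apply/asboolP => xhat [[x' Qx' <-] xhat_min].
    have le_hat : \sum_j energy (err (f x')) j (w j) <=
        \sum_j energy (err (f x)) j (w j).
      by rewrite -!l2sq_measurement !measurementB; apply: xhat_min; exists x.
    have le_delta : l2sq (err (f x)) <= delta.
      rewrite -hdelta; apply: ub_le_sup; last by exists x.
      (* [sup] dominates the elements only of a bounded set; the entrywise bounds on [Q] and the
         codebook supply one. *)
      exists ((B * n)%:R * rho ^+ 2) => _ [z Qz <-]; apply: l2sq_le_const => k.
      rewrite !mxE [rho]splitr; apply: le_trans (ler_normB _ _) _.
      by apply: lerD; [exact: hQrho|apply: hC; exists z].
    have msg z : Q z -> exists m : 'I_N, m.+1 = f z.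
      move=> /hf[fz1 fzN].
      have ltN : ((f z).-1 < N)%N by rewrite prednK// truncn_ge_nat// ltW.
      by exists (Ordinal ltN); rewrite /= prednK.
    have nbadE z : Q z -> exists2 m : 'I_N, m.+1 = f z & ~~ bad m w.
      by move=> /msg[m mE]; exists m.
    have lminmax : lmin <= lmax.
      by apply: lambda_min_le_max => //; exact: Lambda_sym.
    have lmax_ge0 : 0 <= lmax := le_trans (ltW hmin) lminmax.
    have pp : 0 < p * (1 - p) by rewrite mulr_gt0.
    have nB0 : 0 < (n * B)%:R :> R by rewrite ltr0n muln_gt0 hn hB.
    have delta_ge0 : 0 <= delta := le_trans (l2sq_ge0 _) le_delta.
    suff main : p * (1 - p) * lmin * l2sq (x - g (f x')) <=
        (p ^+ 2 * B%:R + p * (1 - p) * lmax) * delta + 2 * t.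
      have normalize (a b : R) : 0 < b ->
          (a * (1 - p) + p * B%:R) / (b * (1 - p)) * (delta / (n * B)%:R) +
          rho ^+ 2 * eps / (b * p * (1 - p)) =
          ((p ^+ 2 * B%:R + p * (1 - p) * a) * delta + 2 * t) /
          (p * (1 - p) * b) / (n * B)%:R.
        move=> b0; rewrite /t natrM; field.
        by rewrite !pnatr_eq0 -!lt0n hn hB !gt_eqF.
      rewrite (normalize lmax lmin hmin).
      by rewrite ler_pM2r ?invr_gt0// ler_pdivlMr ?mulr_gt0// mulrC.
    (* If the minimiser is the codeword of [x], its error is at most [delta], and lmin <= lmax
       suffices. *)
    have [fE|/eqP fN] := eqVneq (f x') (f x).
      rewrite fE -[leLHS]addr0; apply: lerD; last by rewrite mulr_ge0.
      apply: ler_pM => //; first by rewrite mulr_ge0 ?(ltW pp) ?(ltW hmin).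
        exact: l2sq_ge0.
      rewrite -[leLHS]add0r; apply: lerD; last by rewrite ler_pM2l.
      by rewrite mulr_ge0 ?sqr_ge0.
    have [m mE] := nbadE _ Qx'; rewrite /bad mE.
    rewrite (asboolT (ex_intro2 _ _ x' Qx' erefl : C (g (f x')))) (introF eqP fN).
    rewrite /= -ltNge => lower.
    have [m' m'E] := nbadE _ hx; rewrite /bad m'E eqxx.
    rewrite (asboolT (ex_intro2 _ _ x hx erefl : C (g (f x)))) /= -ltNge => upper.
    have ge_mean := mean_energy_ge hB step marginal p_inv hp01 (err (f x')).
    have le_mean := mean_energy_le hB step marginal p_inv hp01 (err (f x)).
    have le_meand : (p ^+ 2 * B%:R + p * (1 - p) * lmax) * l2sq (err (f x)) <=
        (p ^+ 2 * B%:R + p * (1 - p) * lmax) * delta.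
      apply: ler_wpM2l => //.
      by rewrite addr_ge0// mulr_ge0 ?sqr_ge0 ?(ltW pp).
    (* The chain, with z' and z the errors of the minimiser and of the codeword of [x]: p (1 - p)
       lmin |z'|^2 <= mean z' < energy z' + t <= energy z + t < mean z + 2 t, and mean z is bounded
       through [delta]. *)
    move: ge_mean le_mean lower upper; rewrite -/(mean _) -/(mean _) -/lmin -/lmax.
    rewrite -/(err (f x')); lra.
rewrite ltrD2l ltrN2 ltr_pM2r ?expR_gt0//.
(* N <= 2^(B r) < 2^(B r + 1). *)
rewrite powRD ?pnatr_eq0 ?implybT// powRr1//.
apply: (@le_lt_trans _ _ (2 `^ (B%:R * r))); first by rewrite truncn_le ltW.
by rewrite ltr_pMr// ltr1n.
Qed.
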